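(* Let $(g,\tilde g)$ be a weak quasi-homogeneous pencil of bi-degree $(d,D)$ on a smooth manifold $M$, with associated vector field $E$ and automorphism $T(u)=\frac{d-1}{2}u+u(\tilde\nabla E)$ of $T^*M$. Define a new multiplication $u\cdot v:=u\circ T^{-1}(v)$ on $T^*M$, where $\alpha\circ\beta:=\nabla_{g^*\alpha}\beta-\tilde\nabla_{g^*\alpha}\beta$, and denote also by $\cdot$ the induced multiplication on $TM$, using the metric $\tilde g$ (i.e. $X\cdot Y:=\tilde g^*(\tilde g(X)\cdot\tilde g(Y))$). Then: (1) $(M,\cdot,\tilde g,E)$ is a weak $\mathfrak{F}$-manifold with Euler vector field $E$ and identity $e:=\tilde g^*g(E)$. Moreover, $g^*\tilde g=E\cdot$, i.e. $g^*(\tilde g(X))=E\cdot X$ for every $X\in TM$. (2) If $(g,\tilde g)$ is a quasi-homogeneous pencil (of degree $d$, with $E=\mathrm{grad}_g(f)$, viewed as a weak quasi-homogeneous pencil of bi-degree $(d,2-d)$), then $e$ is $\tilde\nabla$-flat (i.e. $\tilde\nabla e=0$) and $L_E(\cdot)=\cdot$ on $TM$.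
   Context: Notation. $\mathcal{X}(M)$, $\mathcal{E}^1(M)$: smooth vector fields and $1$-forms on $M$. ''Metric'' means pseudo-Riemannian metric. For a metric $g$, $g^*$ is the induced metric on $T^*M$; also $g(X)=g(X,\cdot)$ and $g^*\alpha$ is the vector field dual to the $1$-form $\alpha$. $\nabla,R$ ($\tilde\nabla,\tilde R$) are the Levi-Civita connection and curvature of $g$ ($\tilde g$), also on $T^*M$, with $R_{X,Y}=\nabla_X\nabla_Y-\nabla_Y\nabla_X-\nabla_{[X,Y]}$. $L$ is the Lie derivative and $\mathrm{grad}_g(f)=g^*(df)$. Compatibility. For every constant $\lambda$ put $g_\lambda^*:=g^*+\lambda\tilde g^*$ (assumed always non-degenerate), with metric $g_\lambda$, Levi-Civita connection $\nabla^\lambda$, curvature $R^\lambda$. $g,\tilde g$ are almost compatible if $g_\lambda^*\nabla^\lambda_X\alpha=g^*\nabla_X\alpha+\lambda\tilde g^*\tilde\nabla_X\alpha$ for all $X,\alpha$ and constants $\lambda$; compatible if moreover $g_\lambda^*(R^\lambda_{X,Y}\alpha)=g^*(R_{X,Y}\alpha)+\lambda\tilde g^*(\tilde R_{X,Y}\alpha)$ for all $X,Y,\alpha,\lambda$. Quasi-homogeneous pencil of degree $d$ ($d$ constant): a pair $(g,\tilde g)$ of compatible metrics such that (1) there is a smooth function $f$ on $M$ such that $E:=\mathrm{grad}_g(f)$ and $e:=\mathrm{grad}_{\tilde g}(f)$ satisfy $[e,E]=e$, $L_E(g^* )=(d-1)g^*$, $L_e(g^* )=\tilde g^*$, $L_e(\tilde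 g^* )=0$; (2) the operator $T(u):=\frac{d-1}{2}u+u(\tilde\nabla E)$ is an automorphism of $T^*M$, where $u(\tilde\nabla E)$ is the $1$-form $X\mapsto u(\tilde\nabla_XE)$. Weak quasi-homogeneous pencil of bi-degree $(d,D)$ ($d,D$ constants): a pair $(g,\tilde g)$ of compatible metrics such that (1) there is a vector field $E$ on $M$ with $L_E(g)=(1-d)g$ and $L_E(\tilde g)=D\tilde g$; (2) the operator $T(u):=\frac{d-1}{2}u+u(\tilde\nabla E)$ is an automorphism of $T^*M$ and $T(u)=g(E)\circ u$ for every $u\in\mathcal{E}^1(M)$. Any quasi-homogeneous pencil of degree $d$ is also weak quasi-homogeneous of bi-degree $(d,2-d)$. Weak $\mathfrak{F}$-manifold: a manifold $M$ with a multiplication $\cdot$ on $TM$ (a bundle map, bilinear on fibres), a vector field $E$ (the Euler field) and a metric $\tilde g$ such that (1) $\cdot$ is associative, commutative, with unity $e$; (2) $E$ has an inverse $E^{-1}$ with respect to $\cdot$, satisfies $L_E(\cdot)=k\,\cdot$ (i.e. $[E,X\cdot Y]-[E,X]\cdot Y-X\cdot[E,Y]=kX\cdot Y$) and $L_E(\tilde g)=D\tilde g$ for constants $k,D$, and the operator $T(u):=\frac{D+k}{2}u-\tilde g(\tilde\nabla_{\tilde g^*(u)}E)$ is an automorphism of $T^*M$; (3) $\tilde g(X\cdot Y,Z)=\tilde g(X,Y\cdot Z)$ for all $X,Y,Z\in\mathcal{X}(M)$; (4) $\tilde\nabla(\cdot)(X,Y,Z,E)=\tilde\nabla(\cdot)(E,X,Y,Z)$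 for all $X,Y,Z\in\mathcal{X}(M)$, where $\tilde\nabla(\cdot)(X,Y,Z,V):=\tilde g(\tilde\nabla_X(\cdot)(Y,Z),V)$ and $\tilde\nabla_X(\cdot)(Y,Z)=\tilde\nabla_X(Y\cdot Z)-\tilde\nabla_X(Y)\cdot Z-Y\cdot\tilde\nabla_X(Z)$. *)

(* Defs.v *)
From HB Require Import structures.
From mathcomp Require Import all_boot all_order all_algebra ring.
From mathcomp Require Import all_classical all_reals all_analysis.
Import numFieldNormedType.Exports.
Set Implicit Arguments.
Unset Strict Implicit.
Unset Printing Implicit Defensive.
Import Order.TTheory GRing.Theory Num.Theory.
Local Open Scope classical_set_scope.
Local Open Scope ring_scope.

(** * Smooth functions on open subsets of R^n *)

Section SmoothOn.
Variables (R : realType) (n : nat).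
Implicit Types (U : set 'rV[R]_n) (f g : 'rV[R]_n -> R) (k : nat).

(* [U] is meant to be open; only the values of [f] on [U] matter. *)
Fixpoint Ck k U f : Prop :=
  (forall x, U x -> {for x, continuous f}) /\
  match k with
  | 0%N => True
  | k'.+1 => forall i : 'I_n,
      (forall x, U x -> derivable f x (delta_mx 0 i)) /\
      Ck k' U ('D_(delta_mx 0 i) f)
  end.

Definition smooth_on U f : Prop := forall k, Ck k U f.

Lemma Ck_ext k U f g : open U -> (forall x, U x -> f x = g x) ->
  Ck k U f -> Ck k U g.
Proof.
move=> oU; elim: k f g => [|k IH] f g fg /= [cf H].
all: have nfg x : U x -> \near x, f x = g x
  by move=> Ux; exact: filterS fg (open_nbhs_nbhs (conj oU Ux)).
all: have cg x : U x -> {for x, continuous g}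
  by move=> Ux; apply: cvg_trans (near_eq_cvg (nfg x Ux)) _;
     rewrite -(fg _ Ux); exact: cf.
  by split.
split=> // i; have [df Df] := H i; split.
  by move=> x Ux; apply: near_eq_derivable (df x Ux); exact: nfg.
by apply: IH Df => x Ux; apply: near_eq_derive; exact: nfg.
Qed.

Lemma CkW k U f : Ck k.+1 U f -> Ck k U f.
Proof.
elim: k f => [|k IH] f [cf H]; first by split.
by split=> // i; have [df Df] := H i; split=> //; exact: IH.
Qed.

Lemma Ck_cst k U (c : R) : Ck k U (cst c).
Proof.
elim: k c => [|k IH] c; first by split=> // x _; exact: cst_continuous.
split=> [x _|i]; first exact: cst_continuous.
split=> [x _|]; first exact: derivable_cst.
suff -> : 'D_(delta_mx 0 i) (cst c) = cst 0 :> ('rV[R]_n -> R) by [].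
by apply/funext => x; rewrite derive_cst.
Qed.

Lemma Ck_add k U f g : open U -> Ck k U f -> Ck k U g -> Ck k U (f + g).
Proof.
move=> oU; elim: k f g => [|k IH] f g [cf Hf] [cg Hg].
  by split=> // x Ux; exact: continuousD (cf _ Ux) (cg _ Ux).
split=> [x Ux|i]; first exact: continuousD (cf _ Ux) (cg _ Ux).
 have [df Df] := Hf i; have [dg Dg] := Hg i; split=> [x Ux|].
  exact: derivableD (df _ Ux) (dg _ Ux).
apply: Ck_ext (IH _ _ Df Dg) => // x Ux.
by rewrite (deriveD (df _ Ux) (dg _ Ux)).
Qed.

Lemma Ck_mul k U f g : open U -> Ck k U f -> Ck k U g -> Ck k U (f * g).
Proof.
move=> oU; elim: k f g => [|k IH] f g.
  by move=> [cf _] [cg _]; split=> // x Ux; exact: continuousM (cf _ Ux) (cg _ Ux).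
move=> Cf Cg; have [cf Hf] := Cf; have [cg Hg] := Cg.
split=> [x Ux|i]; first exact: continuousM (cf _ Ux) (cg _ Ux).
have [df Df] := Hf i; have [dg Dg] := Hg i; split=> [x Ux|].
  exact: derivableM (df _ Ux) (dg _ Ux).
apply: Ck_ext (Ck_add oU (IH _ _ (CkW Cf) Dg) (IH _ _ (CkW Cg) Df)) => // x Ux.
by rewrite (deriveM (df _ Ux) (dg _ Ux)).
Qed.

End SmoothOn.

(** * Smooth manifolds *)

Section Manifolds.
Variables (R : realType) (n : nat).

Record chart (M : topologicalType) := Chart {
  chart_dom : set M;
  chart_cod : set 'rV[R]_n;
  chart_map : M -> 'rV[R]_n;
  chart_inv : 'rV[R]_n -> M;
  chart_dom_open : open chart_dom;
  chart_cod_open : open chart_cod;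
  chart_mapS : forall x, chart_dom x -> chart_cod (chart_map x);
  chart_invS : forall y, chart_cod y -> chart_dom (chart_inv y);
  chart_mapK : forall x, chart_dom x -> chart_inv (chart_map x) = x;
  chart_invK : forall y, chart_cod y -> chart_map (chart_inv y) = y;
  chart_map_continuous : forall x, chart_dom x -> {for x, continuous chart_map};
  chart_inv_continuous : forall y, chart_cod y -> {for y, continuous chart_inv}
}.

(* The atlas need not be maximal: it has the same smooth functions as the
   maximal atlas containing it. *)
Record smoothManifold := SmoothManifold {
  carrier :> topologicalType;
  carrier_hausdorff : hausdorff_space carrier;
  carrier_second_countable : @second_countable carrier;
  atlas : set (chart carrier);
  atlas_cover : forall x, exists2 c, atlas c & chart_dom c x;
  atlas_smooth : forall c c', atlas c -> atlas c' -> forall i : 'I_n,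
    smooth_on (chart_cod c `&` chart_inv c @^-1` chart_dom c')
              (fun y => chart_map c' (chart_inv c y) 0 i)
}.

Definition smooth (M : smoothManifold) (f : M -> R) : Prop :=
  forall c, atlas c -> smooth_on (chart_cod c) (f \o chart_inv c).

Definition smooth_pred (M : smoothManifold) : {pred M -> R} :=
  fun f => `[< smooth f >].

Record smooth_fun (M : smoothManifold) := SmoothFun {
  smooth_fun_val :> M -> R;
  smooth_funP : smooth_fun_val \in @smooth_pred M
}.

Lemma smooth_subring (M : smoothManifold) : subring_closed (@smooth_pred M).
Proof.
have sC (c : R) : smooth (cst c : M -> R) by move=> ch _ k; exact: Ck_cst.
have sM (f g : M -> R) : smooth f -> smooth g -> smooth (f * g).
  move=> sf sg c ac k.
  change (Ck k (chart_cod c) ((f \o chart_inv c) * (g \o chart_inv c))).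
  exact: (Ck_mul (@chart_cod_open _ c) (sf _ ac k) (sg _ ac k)).
have sD (f g : M -> R) : smooth f -> smooth g -> smooth (f + g).
  move=> sf sg c ac k.
  change (Ck k (chart_cod c) ((f \o chart_inv c) + (g \o chart_inv c))).
  exact: (Ck_add (@chart_cod_open _ c) (sf _ ac k) (sg _ ac k)).
split=> [|f g /asboolP sf /asboolP sg|f g /asboolP sf /asboolP sg];
  apply/asboolP; [exact: sC| |exact: sM].
have -> : f - g = f + (cst (-1) : M -> R) * g.
  by apply/funext => x; rewrite /= mulN1r.
by apply: sD => //; exact: sM.
Qed.

HB.instance Definition _ M := [isSub for @smooth_fun_val M].
HB.instance Definition _ M := [Choice of smooth_fun M by <:].
HB.instance Definition _ M :=
  GRing.SubChoice_isSubComPzRing.Build _ _ (smooth_fun M) (smooth_subring M).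

End Manifolds.

(** * Vector fields and one-forms *)

Section VectorFieldsAndForms.
Variables (R : realType) (n : nat) (M : smoothManifold R n).
Local Notation C := (smooth_fun M).

Lemma smooth_funE (f h : C) : (forall x, f x = h x) -> f = h.
Proof. by move=> fh; apply: val_inj; apply/funext. Qed.

Lemma constf_subproof (c : R) : (cst c : M -> R) \in @smooth_pred R n M.
Proof. by apply/asboolP => ch _ k; exact: Ck_cst. Qed.

Definition constf (c : R) : C := SmoothFun (constf_subproof c).

Lemma constfD c c' : constf (c + c') = constf c + constf c'.
Proof. exact: smooth_funE. Qed.

Lemma constfM c c' : constf (c * c') = constf c * constf c'.
Proof. exact: smooth_funE. Qed.

Lemma constf1 : constf 1 = 1.
Proof. exact: smooth_funE. Qed.

(* A tangent vector at p is a derivation at p of the algebra of smooth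
   functions, so a smooth section of TM is a derivation of that algebra. *)
Definition derivation (X : C -> C) : Prop :=
  (forall (c : R) f h, X (constf c * f + h) = constf c * X f + X h) /\
  (forall f h, X (f * h) = X f * h + f * X h).

Definition derivation_pred : {pred C -> C^o} := fun X => `[< derivation X >].

Record vfield := VField {
  vfield_val : C -> C^o;
  vfieldP : vfield_val \in derivation_pred
}.

Definition vfield_app (X : vfield) (f : C) : C := vfield_val X f.
Coercion vfield_app : vfield >-> Funclass.

HB.instance Definition _ := [isSub for vfield_val].
HB.instance Definition _ := [Choice of vfield by <:].

Lemma derivation_submod : submod_closed derivation_pred.
Proof.
split=> [|a X Y /asboolP[lX mX] /asboolP[lY mY]]; apply/asboolP.
  split=> [c f h|f h]; rewrite /GRing.zero /=.
    by rewrite mulr0 addr0.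
  by rewrite mul0r mulr0 addr0.
pose aXY : C -> C := fun f => a * (X f : C) + (Y f : C).
change (derivation aXY).
by split=> [c f h|f h]; rewrite /aXY ?lX ?lY ?mX ?mY; ring.
Qed.

HB.instance Definition _ :=
  GRing.SubChoice_isSubLmodule.Build _ _ _ vfield derivation_submod.

Lemma vfieldE (X Y : vfield) : (forall f, X f = Y f) -> X = Y.
Proof. by move=> XY; apply: val_inj; apply/funext. Qed.

Lemma vfield_addE (X Y : vfield) f : (X + Y) f = X f + Y f.
Proof. by []. Qed.

Lemma vfield_oppE (X : vfield) f : (- X) f = - X f.
Proof. by []. Qed.

Lemma vfield_scaleE (a : C) (X : vfield) f : (a *: X) f = a * X f.
Proof. by []. Qed.

Lemma vfield_linear (X : vfield) (c : R) f h :
  X (constf c * f + h) = constf c * X f + X h.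
Proof. exact: (asboolW (vfieldP X)).1. Qed.

Lemma vfieldM (X : vfield) f h : X (f * h) = X f * h + f * X h.
Proof. exact: (asboolW (vfieldP X)).2. Qed.

Lemma vfieldD (X : vfield) f h : X (f + h) = X f + X h.
Proof. by have := vfield_linear X 1 f h; rewrite constf1 !mul1r. Qed.

Lemma vfield0 (X : vfield) : X 0 = 0.
Proof. by apply: (addrI (X 0)); rewrite -vfieldD !addr0. Qed.

Lemma vfieldN (X : vfield) f : X (- f) = - X f.
Proof. by apply: (addrI (X f)); rewrite -vfieldD !subrr vfield0. Qed.

Definition vfieldDE := (vfieldD, vfieldN, vfieldM).

Lemma bracket_subproof (X Y : vfield) :
  ((fun f => X (Y f) - Y (X f)) : C -> C^o) \in derivation_pred.
Proof.
apply/asboolP; split=> [c f h|f h].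
  by rewrite !vfield_linear; ring.
by rewrite !vfieldDE; ring.
Qed.

Definition bracket (X Y : vfield) : vfield := VField (bracket_subproof X Y).

Lemma bracketE X Y f : bracket X Y f = X (Y f) - Y (X f).
Proof. by []. Qed.

(* One-forms are C-linear functionals on vector fields. *)
Definition tensorial (a : vfield -> C) : Prop :=
  forall f X Y, a (f *: X + Y) = f * a X + a Y.

Definition tensorial_pred : {pred vfield -> C^o} := fun a => `[< tensorial a >].

Record form := Form {
  form_val : vfield -> C^o;
  formP : form_val \in tensorial_pred
}.

Definition form_app (a : form) (X : vfield) : C := form_val a X.
Coercion form_app : form >-> Funclass.

HB.instance Definition _ := [isSub for form_val].
HB.instance Definition _ := [Choice of form by <:].

Lemma tensorial_submod : submod_closed tensorial_pred.
Proof.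
split=> [|c a b /asboolP la /asboolP lb]; apply/asboolP.
  by move=> f X Y; rewrite /GRing.zero /= mulr0 addr0.
pose cab : vfield -> C := fun X => c * (a X : C) + (b X : C).
change (tensorial cab).
by move=> f X Y; rewrite /cab la lb; ring.
Qed.

HB.instance Definition _ :=
  GRing.SubChoice_isSubLmodule.Build _ _ _ form tensorial_submod.

Definition mkform (a : vfield -> C) (ta : tensorial a) : form :=
  Form (asboolT ta : (a : vfield -> C^o) \in tensorial_pred).

Lemma formE (a b : form) : (forall X, a X = b X) -> a = b.
Proof. by move=> ab; apply: val_inj; apply/funext. Qed.

Lemma form_addE (a b : form) X : (a + b) X = a X + b X.
Proof. by []. Qed.

Lemma form_oppE (a : form) X : (- a) X = - a X.
Proof. by []. Qed.

Lemma form_scaleE (c : C) (a : form) X : (c *: a) X = c * a X.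
Proof. by []. Qed.

Lemma form_tensorial (a : form) : tensorial a.
Proof. exact: (asboolW (formP a)). Qed.

Lemma tensorialD a X Y : tensorial a -> a (X + Y) = a X + a Y.
Proof. by move=> ta; have := ta 1 X Y; rewrite scale1r mul1r. Qed.

Lemma tensorial0 a : tensorial a -> a 0 = 0.
Proof. by move=> ta; apply: (addrI (a 0)); rewrite -tensorialD// !addr0. Qed.

Lemma tensorialZ a f X : tensorial a -> a (f *: X) = f * a X.
Proof. by move=> ta; have := ta f X 0; rewrite tensorial0// !addr0. Qed.

Lemma tensorialN a X : tensorial a -> a (- X) = - a X.
Proof. by move=> ta; rewrite -scaleN1r tensorialZ// mulN1r. Qed.

Lemma dform_subproof (f : C) : tensorial (fun X => X f).
Proof. by []. Qed.

Definition dform (f : C) : form := mkform (dform_subproof f).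

Lemma lie_form_subproof (E : vfield) (a : form) :
  tensorial (fun X => E (a X) - a (bracket E X)).
Proof.
move=> f X Y; have ta := form_tensorial a.
have -> : bracket E (f *: X + Y) = E f *: X + (f *: bracket E X + bracket E Y).
  apply: vfieldE => h; rewrite !(bracketE, vfield_addE, vfield_scaleE) !vfieldDE.
  ring.
rewrite !ta !vfieldDE; ring.
Qed.

(* L_E a *)
Definition lie_form E a : form := mkform (lie_form_subproof E a).

End VectorFieldsAndForms.

(** * Metrics and connections *)

Section Metrics.
Variables (R : realType) (n : nat) (M : smoothManifold R n).
Local Notation C := (smooth_fun M).
Local Notation vfield := (vfield M).
Local Notation form := (form M).
Implicit Types (X Y Z W V E : vfield) (a b u v : form) (f : C) (l : R).

(* [metric_nondeg] says that X |-> g(X, .) is an isomorphism from TM onto T^*M;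
   pointwise nondegeneracy is [metric_nondeg_at] below. *)
Record metric := Metric {
  metric_val :> vfield -> vfield -> C;
  metric_tensorial : forall Z, tensorial (metric_val ^~ Z);
  metric_sym : forall X Y, metric_val X Y = metric_val Y X;
  metric_nondeg : forall a : form,
    exists! X : vfield, forall Y, metric_val X Y = a Y
}.

Lemma metric_tensorialr (g : metric) X : tensorial (g X).
Proof.
by move=> f Y Z; rewrite metric_sym metric_tensorial !(metric_sym _ X).
Qed.

Definition flat (g : metric) (X : vfield) : form :=
  mkform (@metric_tensorialr g X).

Definition sharp (g : metric) (a : form) : vfield :=
  projT1 (cid (metric_nondeg g a)).

Lemma sharpE (g : metric) a Y : g (sharp g a) Y = a Y.
Proof. by rewrite /sharp; case: cid => X [] /=. Qed.

Lemma flatK g : cancel (flat g) (sharp g).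
Proof.
move=> X; rewrite /sharp; case: cid => Y [gY uY] /=.
by apply: uY => Z.
Qed.

Lemma sharpK g : cancel (sharp g) (flat g).
Proof. by move=> a; apply: formE => X; rewrite -[LHS]/(g _ _) sharpE. Qed.

Lemma metric_inj (g : metric) X Y : (forall Z, g X Z = g Y Z) -> X = Y.
Proof. by move=> XY; rewrite -(flatK g X) -(flatK g Y); congr sharp; exact: formE. Qed.

Lemma metric_nondeg_at (g : metric) (p : M) (X : vfield) :
  (forall Y, g X Y p = 0) -> forall f, X f p = 0.
Proof.
move=> gX f; rewrite -(gX (sharp g (dform f))).
by rewrite metric_sym sharpE.
Qed.

Definition cometric (g : metric) (a b : form) : C := g (sharp g a) (sharp g b).

Definition grad (g : metric) (f : C) : vfield := sharp g (dform f).

(* L_E g and L_E g^* *)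
Definition lie_metric E (g : metric) X Y : C :=
  E (g X Y) - g (bracket E X) Y - g X (bracket E Y).

Definition lie_cometric E (g : metric) a b : C :=
  E (cometric g a b) - cometric g (lie_form E a) b - cometric g a (lie_form E b).

Record connection := Connection {
  nabla :> vfield -> vfield -> vfield;
  nabla_tensorial : forall f X Y Z,
    nabla (f *: X + Y) Z = f *: nabla X Z + nabla Y Z;
  nabla_additive : forall X Y Z, nabla X (Y + Z) = nabla X Y + nabla X Z;
  nabla_leibniz : forall f X Y, nabla X (f *: Y) = X f *: Y + f *: nabla X Y
}.

Definition is_levi_civita (g : metric) (D : connection) : Prop :=
  (forall X Y Z, X (g Y Z) = g (D X Y) Z + g Y (D X Z)) /\
  (forall X Y, D X Y - D Y X = bracket X Y).

Section Koszul.
Variable g : metric.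

Let gDl X Y Z : g (X + Y) Z = g X Z + g Y Z.
Proof. exact: (tensorialD _ _ (metric_tensorial g Z)). Qed.
Let gNl X Z : g (- X) Z = - g X Z.
Proof. exact: (tensorialN _ (metric_tensorial g Z)). Qed.
Let gZl f X Z : g (f *: X) Z = f * g X Z.
Proof. exact: (tensorialZ _ _ (metric_tensorial g Z)). Qed.
Let gDr X Y Z : g X (Y + Z) = g X Y + g X Z.
Proof. exact: (tensorialD _ _ (metric_tensorialr g X)). Qed.
Let gNr X Y : g X (- Y) = - g X Y.
Proof. exact: (tensorialN _ (metric_tensorialr g X)). Qed.
Let gZr f X Y : g X (f *: Y) = f * g X Y.
Proof. exact: (tensorialZ _ _ (metric_tensorialr g X)). Qed.
Let gE := (gDl, gNl, gZl, gDr, gNr, gZr).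

Let brN X Y : bracket X Y = - bracket Y X.
Proof.
by apply: vfieldE => f; rewrite vfield_oppE !bracketE; ring.
Qed.
Let brDr X Y Z : bracket X (Y + Z) = bracket X Y + bracket X Z.
Proof.
apply: vfieldE => f; rewrite !(vfield_addE, bracketE) !vfieldDE; ring.
Qed.
Let brZr f X Y : bracket X (f *: Y) = X f *: Y + f *: bracket X Y.
Proof.
apply: vfieldE => h.
rewrite !(vfield_addE, bracketE, vfield_scaleE) !vfieldDE; ring.
Qed.
Let brDl X Y Z : bracket (Y + Z) X = bracket Y X + bracket Z X.
Proof. by rewrite brN brDr opprD -!brN. Qed.
Let brZl f X Y : bracket (f *: Y) X = - (X f *: Y) + f *: bracket Y X.
Proof. by rewrite brN brZr opprD (brN Y) scalerN. Qed.
Let brE := (brDr, brZr, brDl, brZl).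

Let koszul X Y Z : C :=
  X (g Y Z) + Y (g X Z) - Z (g X Y)
  + g (bracket X Y) Z - g (bracket X Z) Y - g (bracket Y Z) X.

Let koszul_tensorial X Y : tensorial (koszul X Y).
Proof.
move=> f Z W; rewrite /koszul !brE !gE !vfieldDE !vfield_addE !vfield_scaleE.
rewrite (metric_sym g Z X) (metric_sym g Z Y); ring.
Qed.

Let half2 : constf M 2^-1 + constf M 2^-1 = 1.
Proof. by rewrite -constfD -constf1; congr constf; field. Qed.

Let koszulP : exists D : vfield -> vfield -> vfield,
  forall X Y Z, g (D X Y) Z = constf M 2^-1 * koszul X Y Z.
Proof.
exists (fun X Y => constf M 2^-1 *: sharp g (mkform (koszul_tensorial X Y))).
by move=> X Y Z; rewrite gZl sharpE.
Qed.

Let halfK (a b : C) : a = b + b -> constf M 2^-1 * a = b.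
Proof. by move=> ->; rewrite mulrDr -mulrDl half2 mul1r. Qed.

Lemma levi_civita_exists : exists D : connection, is_levi_civita g D.
Proof.
have [D gD] := koszulP.
have Dt f X Y Z : D (f *: X + Y) Z = f *: D X Z + D Y Z.
  apply: (@metric_inj g) => W; rewrite !gE !gD /koszul.
  rewrite mulrCA -mulrDr; congr (_ * _).
  rewrite !brE !gE !vfieldDE !vfield_addE !vfield_scaleE; ring.
have Da X Y Z : D X (Y + Z) = D X Y + D X Z.
  apply: (@metric_inj g) => W; rewrite !gE !gD /koszul -mulrDr.
  by congr (_ * _); rewrite !brE !gE !vfieldDE !vfield_addE; ring.
have Dl f X Y : D X (f *: Y) = X f *: Y + f *: D X Y.
  apply: (@metric_inj g) => W; rewrite !gE !gD.
  have -> : koszul X (f *: Y) W =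
      f * koszul X Y W + (X f * g Y W + X f * g Y W).
    rewrite /koszul !brE !gE !vfieldDE !vfield_scaleE.
    rewrite (metric_sym g Y X); ring.
  rewrite mulrDr (halfK (erefl (X f * g Y W + X f * g Y W))); ring.
exists (Connection Dt Da Dl); split=> [X Y Z|X Y] /=.
  rewrite (metric_sym g Y (D X Z)) !gD -mulrDr; symmetry; apply: halfK.
  rewrite /koszul (metric_sym g Z Y) (brN Z Y) gNl; ring.
apply: (@metric_inj g) => Z; rewrite !gE !gD -mulrBr; apply: halfK.
rewrite /koszul (brN Y X) gNl (metric_sym g Y X); ring.
Qed.

Lemma levi_civita_unique (D1 D2 : connection) :
  is_levi_civita g D1 -> is_levi_civita g D2 -> forall X Y, D1 X Y = D2 X Y.
Proof.
have [D gD] := koszulP.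
have K (D0 : connection) : is_levi_civita g D0 ->
    forall X Y, D0 X Y = D X Y.
  move=> [mD tD] X Y; apply: (@metric_inj g) => Z; rewrite gD.
  symmetry; apply: halfK; rewrite /koszul !mD -!tD !gE.
  rewrite (metric_sym g Y (D0 X Z)) (metric_sym g X (D0 Y Z)).
  rewrite (metric_sym g X (D0 Z Y)); ring.
by move=> L1 L2 X Y; rewrite !K.
Qed.

End Koszul.

Definition levi_civita (g : metric) : connection :=
  projT1 (cid (levi_civita_exists g)).

Lemma levi_civitaP g : is_levi_civita g (levi_civita g).
Proof. exact: projT2 (cid (levi_civita_exists g)). Qed.

Lemma nabla_form_subproof (D : connection) X (a : form) :
  tensorial (fun Y => X (a Y) - a (D X Y)).
Proof.
move=> f Y Z; have ta := form_tensorial a.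
rewrite nabla_additive nabla_leibniz -addrA !ta !vfieldDE; ring.
Qed.

(* The connection induced on the cotangent bundle. *)
Definition nabla_form (D : connection) X a : form :=
  mkform (@nabla_form_subproof D X a).

Definition curvature_form (D : connection) X Y a : form :=
  nabla_form D X (nabla_form D Y a) - nabla_form D Y (nabla_form D X a)
  - nabla_form D (bracket X Y) a.

Lemma contract_nabla_subproof (D : connection) (E : vfield) (u : form) :
  tensorial (fun X => u (D X E)).
Proof. by move=> f X Y; rewrite nabla_tensorial form_tensorial. Qed.

(* u(D E) : X |-> u(D_X E) *)
Definition contract_nabla D E u : form :=
  mkform (@contract_nabla_subproof D E u).

(** * Pencils of metrics *)

(* [gl] is the metric g_l whose dual is g_l^* = g^* + l gt^*. *)
Definition pencil_metric (g gt : metric) (l : R) (gl : metric) : Prop :=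
  forall a, sharp gl a = sharp g a + constf M l *: sharp gt a.

Definition nondegenerate_pencil (g gt : metric) : Prop :=
  forall l, exists gl, pencil_metric g gt l gl.

Definition almost_compatible (g gt : metric) : Prop :=
  nondegenerate_pencil g gt /\
  forall l gl, pencil_metric g gt l gl -> forall X a,
    sharp gl (nabla_form (levi_civita gl) X a) =
    sharp g (nabla_form (levi_civita g) X a)
    + constf M l *: sharp gt (nabla_form (levi_civita gt) X a).

Definition compatible (g gt : metric) : Prop :=
  almost_compatible g gt /\
  forall l gl, pencil_metric g gt l gl -> forall X Y a,
    sharp gl (curvature_form (levi_civita gl) X Y a) =
    sharp g (curvature_form (levi_civita g) X Y a)
    + constf M l *: sharp gt (curvature_form (levi_civita gt) X Y a).

Definition cotangent_automorphism (T : form -> form) : Prop :=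
  (forall f u v, T (f *: u + v) = f *: T u + T v) /\ bijective T.

Definition pencilT (gt : metric) (d : R) (E : vfield) (u : form) : form :=
  constf M ((d - 1) / 2) *: u + contract_nabla (levi_civita gt) E u.

(* a o b = nabla_{g^*a} b - nablat_{g^*a} b *)
Definition circ (g gt : metric) (a b : form) : form :=
  nabla_form (levi_civita g) (sharp g a) b
  - nabla_form (levi_civita gt) (sharp g a) b.

Definition qh_pencil (g gt : metric) (d : R) (f : C) : Prop :=
  let E := grad g f in let e := grad gt f in
  [/\ compatible g gt,
      [/\ bracket e E = e,
          forall a b, lie_cometric E g a b = constf M (d - 1) * cometric g a b,
          forall a b, lie_cometric e g a b = cometric gt a b &
          forall a b, lie_cometric e gt a b = 0] &
      cotangent_automorphism (pencilT gt d E)].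

Definition weak_qh_pencil (g gt : metric) (d D : R) (E : vfield) : Prop :=
  [/\ compatible g gt,
      (forall X Y, lie_metric E g X Y = constf M (1 - d) * g X Y) /\
      (forall X Y, lie_metric E gt X Y = constf M D * gt X Y),
      cotangent_automorphism (pencilT gt d E) &
      forall u, pencilT gt d E u = circ g gt (flat g E) u].

(* u . v = u o T^-1(v); [T] is bijective whenever this is used, so that
   [xget] picks the unique preimage. *)
Definition cotangent_mul (g gt : metric) (d : R) (E : vfield) (u v : form) : form :=
  circ g gt u (xget 0 [set w | pencilT gt d E w = v]).

Definition tangent_mul (g gt : metric) (d : R) (E X Y : vfield) : vfield :=
  sharp gt (cotangent_mul g gt d E (flat gt X) (flat gt Y)).

(** * Weak F-manifolds *)

Definition lie_mul (E : vfield) (mul : vfield -> vfield -> vfield) X Y : vfield :=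
  bracket E (mul X Y) - mul (bracket E X) Y - mul X (bracket E Y).

Definition nabla_mul (D : connection) (mul : vfield -> vfield -> vfield) X Y Z
    : vfield :=
  D X (mul Y Z) - mul (D X Y) Z - mul Y (D X Z).

Definition nabla_mul_flat (gt : metric) mul X Y Z V : C :=
  gt (nabla_mul (levi_civita gt) mul X Y Z) V.

Definition weak_Fmanifold (mul : vfield -> vfield -> vfield) (gt : metric)
    (E e : vfield) : Prop :=
  [/\ [/\ forall f X Y Z, mul (f *: X + Y) Z = f *: mul X Z + mul Y Z,
          forall f X Y Z, mul X (f *: Y + Z) = f *: mul X Y + mul X Z,
          associative mul, commutative mul & left_id e mul],
      (exists Einv, mul E Einv = e) /\
      (exists k D : R,
        [/\ forall X Y, lie_mul E mul X Y = constf M k *: mul X Y,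
            forall X Y, lie_metric E gt X Y = constf M D * gt X Y &
            cotangent_automorphism (fun u =>
              constf M ((D + k) / 2) *: u
              - flat gt (levi_civita gt (sharp gt u) E))]),
      forall X Y Z, gt (mul X Y) Z = gt X (mul Y Z) &
      forall X Y Z,
        nabla_mul_flat gt mul X Y Z E = nabla_mul_flat gt mul E X Y Z].

End Metrics.

(* Main.v *)
Require Import Defs.
From mathcomp Require Import all_boot all_order all_algebra ring.
From mathcomp Require Import all_classical all_reals all_analysis.
Import GRing.Theory.
Local Open Scope ring_scope.
Set Implicit Arguments.
Unset Strict Implicit.
Unset Printing Implicit Defensive.

(** Everything happens in the algebra of the smooth functions C, its derivations
and the C-linear forms on them; no coordinates are used.

Write A = g^*, B = gt^*, and S_X a for the difference of the two Levi-Civita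
derivatives of the form a along X, so that u o v = S_(A u) v. Both connections
are torsion-free, hence (S_X a)(Y) is symmetric in X and Y.

Compatibility is only used at the parameter 1, with G = A + B the dual of the
metric g_1. Symmetry of the difference between the connections of g_1 and gt
turns almost compatibility into A (S_(B u) a) = B (S_(A u) a)
([almost_compatible_diff]). Because of it the right multiplications u |-> u o a
are self-adjoint for gt^*, as they are for g^*. The curvature condition, paired
with a form and simplified by metricity of the connections, loses all its second order
terms and becomes (u o a) o b = (u o b) o a ([compatible_circ]).

In a weak quasi-homogeneous pencil T is the left multiplication by g(E) for o.
Applying the last identity to u = g(E) gives T a o b = T b o a, which is
commutativity of u . v = u o T^-1(v); the identity itself then reads
(u . a) . b = (u . b) . a, and associativity follows. The form g(E) is the unit
by construction, and A = B (gt(E) . _) comes from [almost_compatible_diff].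

The flow of E rescales both metrics by constants, so the Lie derivative along E
commutes with both Levi-Civita connections ([lie_nabla]), with T, and rescales
the product: on forms by d - 1, on fields by D + d - 1 ([lie_tangent_mul]). The
derivative of the product along E is the Lie derivative corrected by the
covariant derivative of E, which T encodes; comparing it with the derivative of
gt(Y . Z, E) = g^*(gt(Y), gt(Z)) gives the last axiom ([nabla_mul_euler]).

For a quasi-homogeneous pencil, L_E gt^* is computed from gt^* = L_e g^* and
[e, E] = e. A gradient field that rescales a metric with factor c has covariant
derivative c / 2 times the identity ([homothetic_grad]). For E and g this gives
the formula for T, so that the pencil is weak quasi-homogeneous of bi-degree
(d, 2 - d); for e and gt, where c = 0, it says that e is flat. *)

(** * Tensor calculus for a metric and its Levi-Civita connection *)

Section TensorCalculus.
Variables (R : realType) (n : nat) (M : smoothManifold R n).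
Local Notation C := (smooth_fun M).
Local Notation vfield := (vfield M).
Local Notation form := (Defs.form M).
Implicit Types (X Y Z W E : vfield) (a b c u v w : form) (f : C) (g : metric M).
Implicit Types (D : connection M).

Lemma formDr a X Y : a (X + Y) = a X + a Y.
Proof. exact: tensorialD (form_tensorial a). Qed.

Lemma formNr a X : a (- X) = - a X.
Proof. exact: tensorialN (form_tensorial a). Qed.

Lemma formZr a f X : a (f *: X) = f * a X.
Proof. exact: tensorialZ (form_tensorial a). Qed.

Lemma metricDl g X Y Z : g (X + Y) Z = g X Z + g Y Z.
Proof. exact: (tensorialD _ _ (metric_tensorial g Z)). Qed.

Lemma metricNl g X Z : g (- X) Z = - g X Z.
Proof. exact: (tensorialN _ (metric_tensorial g Z)). Qed.

Lemma metricZl g f X Z : g (f *: X) Z = f * g X Z.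
Proof. exact: (tensorialZ _ _ (metric_tensorial g Z)). Qed.

Lemma metricDr g X Y Z : g X (Y + Z) = g X Y + g X Z.
Proof. by rewrite Defs.metric_sym metricDl !(Defs.metric_sym g X). Qed.

Lemma metricNr g X Y : g X (- Y) = - g X Y.
Proof. by rewrite Defs.metric_sym metricNl Defs.metric_sym. Qed.

Lemma metricZr g f X Y : g X (f *: Y) = f * g X Y.
Proof. by rewrite Defs.metric_sym metricZl Defs.metric_sym. Qed.

Lemma flatE g X Y : flat g X Y = g X Y.
Proof. by []. Qed.

Lemma dformE f X : dform f X = X f.
Proof. by []. Qed.

Lemma nabla_formE D X a Y : nabla_form D X a Y = X (a Y) - a (D X Y).
Proof. by []. Qed.

Lemma lie_formE E a X : lie_form E a X = E (a X) - a (bracket E X).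
Proof. by []. Qed.

Lemma contract_nablaE D E u X : contract_nabla D E u X = u (D X E).
Proof. by []. Qed.

Lemma cometricE g a b : cometric g a b = a (sharp g b).
Proof. exact: sharpE. Qed.

Definition tensorE :=
  (form_addE, form_oppE, form_scaleE, formDr, formNr, formZr,
   metricDl, metricNl, metricZl, metricDr, metricNr, metricZr).

Lemma form_sharpC g a b : a (sharp g b) = b (sharp g a).
Proof. by rewrite -[LHS](sharpE g) Defs.metric_sym sharpE. Qed.

(** A metric makes every field visible to the forms. *)
Lemma form_inj X Y g : (forall a, a X = a Y) -> X = Y.
Proof.
move=> aXY; apply: (@metric_inj _ _ _ g) => Z.
by rewrite Defs.metric_sym (Defs.metric_sym g Y) -!flatE.
Qed.

Lemma sharp_inj g : injective (sharp g).
Proof. exact: can_inj (sharpK g). Qed.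

Lemma flat_inj g : injective (flat g).
Proof. exact: can_inj (flatK g). Qed.

Lemma flatD g X Y : flat g (X + Y) = flat g X + flat g Y.
Proof. by apply: formE => Z; rewrite !(tensorE, flatE). Qed.

Lemma flatN g X : flat g (- X) = - flat g X.
Proof. by apply: formE => Z; rewrite !(tensorE, flatE). Qed.

Lemma flatZ g f X : flat g (f *: X) = f *: flat g X.
Proof. by apply: formE => Z; rewrite !(tensorE, flatE). Qed.

Lemma sharpD g a b : sharp g (a + b) = sharp g a + sharp g b.
Proof. by apply: (@flat_inj g); rewrite flatD !sharpK. Qed.

Lemma sharpN g a : sharp g (- a) = - sharp g a.
Proof. by apply: (@flat_inj g); rewrite flatN !sharpK. Qed.

Lemma sharpZ g f a : sharp g (f *: a) = f *: sharp g a.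
Proof. by apply: (@flat_inj g); rewrite flatZ !sharpK. Qed.

Lemma nablaDl D X Y Z : D (X + Y) Z = D X Z + D Y Z.
Proof. by have := nabla_tensorial D 1 X Y Z; rewrite !scale1r. Qed.

Lemma nabla0l D Z : D 0 Z = 0.
Proof. by apply: (addrI (D 0 Z)); rewrite -nablaDl !addr0. Qed.

Lemma nablaZl D f X Z : D (f *: X) Z = f *: D X Z.
Proof. by have := nabla_tensorial D f X 0 Z; rewrite nabla0l !addr0. Qed.

Lemma nabla_formD D X a b :
  nabla_form D X (a + b) = nabla_form D X a + nabla_form D X b.
Proof. by apply: formE => Y; rewrite !(tensorE, nabla_formE, vfieldDE); ring. Qed.

(** The constant 1/2 is a smooth function. *)
Lemma double_eq0 (f : C) : f + f = 0 -> f = 0.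
Proof.
move=> ff0; have : constf M 2^-1 * (f + f) = 0 by rewrite ff0 mulr0.
by rewrite mulrDr -mulrDl -constfD (_ : 2^-1 + 2^-1 = 1) ?constf1 ?mul1r//; field.
Qed.

Section LeviCivita.
Variable g : metric M.
Local Notation D := (levi_civita g).

Lemma levi_civita_metric X Y Z : X (g Y Z) = g (D X Y) Z + g Y (D X Z).
Proof. exact: (levi_civitaP g).1. Qed.

Lemma levi_civita_torsion X Y : D X Y - D Y X = bracket X Y.
Proof. exact: (levi_civitaP g).2. Qed.

(** The right-hand side is the exterior derivative of a at (X, Y), which does not
depend on the metric: this is how torsion-freeness is used for forms. *)
Lemma levi_civita_form_torsion a X Y :
  nabla_form D X a Y - nabla_form D Y a X = X (a Y) - Y (a X) - a (bracket X Y).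
Proof. by rewrite !nabla_formE -levi_civita_torsion !tensorE; ring. Qed.

Lemma nabla_flat X Y : nabla_form D X (flat g Y) = flat g (D X Y).
Proof.
by apply: formE => Z; rewrite nabla_formE !flatE levi_civita_metric; ring.
Qed.

Lemma nabla_sharp X a : sharp g (nabla_form D X a) = D X (sharp g a).
Proof. by rewrite -{1}(sharpK g a) nabla_flat flatK. Qed.

Lemma nabla_form_cometric X a b :
  X (a (sharp g b)) = nabla_form D X a (sharp g b) + nabla_form D X b (sharp g a).
Proof.
rewrite [nabla_form D X a _]nabla_formE -nabla_sharp !(form_sharpC g a); ring.
Qed.

Lemma lie_metric_nabla E X Y : lie_metric E g X Y = g (D X E) Y + g X (D Y E).
Proof.
by rewrite /lie_metric levi_civita_metric -!levi_civita_torsion !tensorE; ring.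
Qed.

End LeviCivita.
End TensorCalculus.

(** * The difference tensor of a compatible pair *)

Section Pencils.
Variables (R : realType) (n : nat) (M : smoothManifold R n) (g gt : metric M).
Local Notation C := (smooth_fun M).
Local Notation vfield := (vfield M).
Local Notation form := (Defs.form M).
Implicit Types (X Y Z W E : vfield) (a b c u v w : form) (f : C).
Local Notation D := (levi_civita g).
Local Notation Dt := (levi_civita gt).

Lemma nabla_diff_subproof X a : tensorial (fun Y => a (Dt X Y) - a (D X Y)).
Proof.
by move=> f Y Z; rewrite !(nabla_additive, nabla_leibniz, tensorE); ring.
Qed.

(** The difference D_X a - Dt_X a on forms: derivatives of forms are dual to
those of fields, which reverses the order of the two connections. *)
Definition nabla_diff X a : form := mkform (nabla_diff_subproof X a).
Local Notation S := nabla_diff.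

Lemma nabla_diffE X a Y : S X a Y = a (Dt X Y) - a (D X Y).
Proof. by []. Qed.

Lemma nabla_diff_nabla X a : S X a = nabla_form D X a - nabla_form Dt X a.
Proof. by apply: formE => Y; rewrite nabla_diffE !tensorE !nabla_formE; ring. Qed.

Lemma circE u v : circ g gt u v = S (sharp g u) v.
Proof. by rewrite nabla_diff_nabla. Qed.

Lemma nabla_diffDl X Y a : S (X + Y) a = S X a + S Y a.
Proof. by apply: formE => Z; rewrite !(nabla_diffE, tensorE, nablaDl); ring. Qed.

Lemma nabla_diffZl f X a : S (f *: X) a = f *: S X a.
Proof. by apply: formE => Z; rewrite !(nabla_diffE, tensorE, nablaZl); ring. Qed.

(** Each connection is torsion-free, so the antisymmetric part of each derivative
of a is the exterior derivative of a, and cancels in the difference. *)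
Lemma nabla_diffC X Y a : S X a Y = S Y a X.
Proof.
apply/eqP; rewrite -subr_eq0 !nabla_diff_nabla !tensorE.
have := levi_civita_form_torsion g a X Y.
rewrite -(levi_civita_form_torsion gt) => /eqP; rewrite -subr_eq0.
by apply: etrans; congr (_ == _); ring.
Qed.

Lemma pencil_metric1 g1 : pencil_metric g gt 1 g1 ->
  forall a, sharp g1 a = sharp g a + sharp gt a.
Proof. by move=> g1P a; rewrite g1P constf1 scale1r. Qed.

(** With g_1 the member of the pencil at 1, Q_X a = (D^1 - Dt)_X a is symmetric by
torsion-freeness and g_1^*(Q_X a) = g^*(S_X a). Evaluating Q at the fields
g_1^* u = g^* u + gt^* u and g_1^* v, the pure g^* terms cancel by symmetry of
S, and the mixed terms are the claim. *)
Lemma almost_compatible_diff : almost_compatible g gt ->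
  forall u a, sharp g (S (sharp gt u) a) = sharp gt (S (sharp g u) a).
Proof.
move=> [nd ac] u a; have [g1 g1P] := nd 1.
have G := pencil_metric1 g1P.
pose Q X := nabla_form (levi_civita g1) X a - nabla_form Dt X a.
have QC X Y : Q X Y = Q Y X.
  apply/eqP; rewrite -subr_eq0 /Q !tensorE.
  have := levi_civita_form_torsion g1 a X Y.
  rewrite -(levi_civita_form_torsion gt) => /eqP; rewrite -subr_eq0.
  by apply: etrans; congr (_ == _); ring.
have GQ X : sharp g1 (Q X) = sharp g (S X a).
  rewrite sharpD sharpN (ac _ _ g1P) constf1 scale1r G nabla_diff_nabla !sharpD sharpN.
  by rewrite opprD addrACA subrr addr0.
apply: (form_inj g) => v.
have := QC (sharp g1 u) (sharp g1 v).
rewrite form_sharpC GQ [RHS]form_sharpC GQ !(form_sharpC g _ (S _ _)).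
rewrite !G !nabla_diffDl !tensorE (nabla_diffC (sharp g v)) => /addrI ->.
by rewrite nabla_diffC form_sharpC.
Qed.

(** Put P = D^1 - D and Q = D^1 - Dt, with D^1 the connection of g_1. Almost
compatibility says gt^* Q = - g^* P, so the first order terms of the curvature
condition combine into derivatives of zero, leaving
(S_X b)(g^* P_Y a) = (S_Y b)(g^* P_X a). Moreover P along g_1^* v is
- S along gt^* v, by [almost_compatible_diff]. The identity thus involves S
alone; symmetry of S and of the pairings rearranges it into the claim. *)
Lemma compatible_circ : compatible g gt ->
  forall u a b, circ g gt (circ g gt u a) b = circ g gt (circ g gt u b) a.
Proof.
move=> [ac cp] u a b; have [nd acE] := ac; have [g1 g1P] := nd 1.
have G := pencil_metric1 g1P; have AB := almost_compatible_diff ac.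
pose D1 := levi_civita g1.
have [P D1E] : exists P : vfield -> form -> form,
    forall X c, nabla_form D1 X c = P X c + nabla_form D X c.
  by exists (fun X c => nabla_form D1 X c - nabla_form D X c) => X c; rewrite subrK.
have [Q D1Et] : exists Q : vfield -> form -> form,
    forall X c, nabla_form D1 X c = Q X c + nabla_form Dt X c.
  by exists (fun X c => nabla_form D1 X c - nabla_form Dt X c) => X c; rewrite subrK.
have acD X (c : form) : sharp g1 (nabla_form D1 X c) =
    sharp g (nabla_form D X c) + sharp gt (nabla_form Dt X c).
  by rewrite (acE _ _ g1P) constf1 scale1r.
have PQ X (c : form) : sharp gt (Q X c) = - sharp g (P X c).
  have := acD X c; rewrite G {1}D1E D1Et !sharpD addrACA -[RHS]add0r.
  by move=> /addIr/eqP; rewrite addrC addr_eq0 => /eqP.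
have dPQ X Y (c d : form) : d (sharp g (nabla_form D X (P Y c))) +
    d (sharp gt (nabla_form Dt X (Q Y c))) = - S X d (sharp g (P Y c)).
  rewrite (form_sharpC g d) (form_sharpC gt d).
  have Hg := nabla_form_cometric g X d (P Y c).
  have := nabla_form_cometric gt X d (Q Y c).
  rewrite PQ !formNr vfieldN Hg nabla_diff_nabla form_addE form_oppE => H.
  apply/eqP; rewrite -subr_eq0; move/eqP: H; rewrite eq_sym -subr_eq0.
  by apply: etrans; congr (_ == _); ring.
have SP X Y (c d : form) : S X d (sharp g (P Y c)) = S Y d (sharp g (P X c)).
  have DD Z W : d (sharp g1 (nabla_form D1 Z (nabla_form D1 W c))) =
      - S Z d (sharp g (P W c)) + d (sharp g (nabla_form D Z (nabla_form D W c)))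
      + d (sharp gt (nabla_form Dt Z (nabla_form Dt W c))).
    rewrite acD {1}D1E D1Et !nabla_formD.
    rewrite !(sharpD g, sharpD gt, formDr) -dPQ; ring.
  have := congr1 (form_app d) (cp _ _ g1P X Y c); rewrite constf1 scale1r.
  rewrite /curvature_form !(sharpD, sharpN, formDr, formNr) !DD acD formDr => H.
  apply/esym/eqP; rewrite -subr_eq0; move/eqP: H; rewrite -subr_eq0.
  by apply: etrans; congr (_ == _); ring.
have PG v (c : form) : P (sharp g1 v) c = - S (sharp gt v) c.
  apply: (@sharp_inj _ _ _ g1).
  have GP X : sharp g1 (P X c) = - sharp gt (S X c).
    rewrite nabla_diff_nabla -[nabla_form D X c](addKr (P X c)) -D1E D1Et.
    by rewrite addrA addrK sharpD sharpN PQ G -opprD opprK addrC.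
  by rewrite GP G nabla_diffDl sharpD sharpN G AB addrC.
(* The field g^* u is written as gt^* t, where P is known along g_1^* t. *)
rewrite !circE -(flatK gt (sharp g u)); set t := flat gt _.
apply: formE => X; rewrite !(nabla_diffC _ X) -(flatK g1 X); set r := flat g1 X.
(* Exchange X = g_1^* r with g_1^* t. *)
have -> : S (sharp g1 r) b (sharp g (S (sharp gt t) a)) =
    S (sharp g1 t) b (sharp g (S (sharp gt r) a)).
  by rewrite -[S (sharp gt t) a]opprK -PG sharpN formNr SP PG sharpN formNr opprK.
rewrite !G !nabla_diffDl !form_addE; congr (_ + _); last exact: form_sharpC.
by rewrite AB form_sharpC -AB.
Qed.
End Pencils.

(** * Lie derivatives along homothetic fields *)

Section LieDerivatives.
Variables (R : realType) (n : nat) (M : smoothManifold R n).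
Local Notation C := (smooth_fun M).
Local Notation vfield := (vfield M).
Local Notation form := (Defs.form M).
Implicit Types (X Y Z W E F : vfield) (a b c u v w : form) (f : C).
Implicit Types (g : metric M) (l : R).

Lemma constfN l : constf M (- l) = - constf M l.
Proof. exact: smooth_funE. Qed.

Lemma jacobi X Y Z :
  bracket X (bracket Y Z) = bracket (bracket X Y) Z + bracket Y (bracket X Z).
Proof.
by apply: vfieldE => f; rewrite !(vfield_addE, bracketE, vfieldDE); ring.
Qed.

Lemma bracketB X Y Z : bracket X (Y - Z) = bracket X Y - bracket X Z.
Proof.
by apply: vfieldE => f;
  rewrite !(vfield_addE, vfield_oppE, bracketE, vfieldDE); ring.
Qed.

Lemma lie_form_bracket E F a :
  lie_form (bracket E F) a = lie_form E (lie_form F a) - lie_form F (lie_form E a).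
Proof.
apply: formE => X; rewrite !tensorE !lie_formE bracketE !vfieldDE.
rewrite (jacobi E F X) formDr; ring.
Qed.

Lemma vfield_constf X l : X (constf M l) = 0.
Proof.
have X1 : X 1 = 0.
  by apply: (addrI (X 1)); rewrite addr0 -{3}[1]mulr1 vfieldM mulr1 mul1r.
by have := vfield_linear X l 1 0; rewrite addr0 vfield0 X1 mulr0 mulr1 addr0.
Qed.

(** Torsion-freeness along the fixed field E. *)
Lemma nabla_lie_form g E u :
  nabla_form (levi_civita g) E u = lie_form E u - contract_nabla (levi_civita g) E u.
Proof.
apply: formE => X; rewrite !tensorE nabla_formE lie_formE contract_nablaE.
by rewrite -(levi_civita_torsion g) !tensorE; ring.
Qed.

(** The derivative of an inverse: g^* is inverse to g, hence the sign. *)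
Lemma lie_cometric_flat E g X Y :
  lie_cometric E g (flat g X) (flat g Y) = - lie_metric E g X Y.
Proof.
rewrite /lie_cometric !cometricE !flatK (form_sharpC g (flat g X)) flatK.
by rewrite !lie_formE !flatE /lie_metric !(Defs.metric_sym g Y); ring.
Qed.

Definition homothetic g l E := forall X Y, lie_metric E g X Y = constf M l * g X Y.

Lemma homothetic_cometric g l E :
  (forall a b, lie_cometric E g a b = constf M l * cometric g a b) ->
  homothetic g (- l) E.
Proof.
move=> H X Y; rewrite -[LHS]opprK -lie_cometric_flat H cometricE flatK flatE.
by rewrite constfN mulNr.
Qed.

Section Homothetic.
Variables (g : metric M) (l : R) (E : vfield).
Hypothesis hE : homothetic g l E.
Local Notation D := (levi_civita g).

Lemma homothetic_app X Y :
  E (g X Y) = constf M l * g X Y + g (bracket E X) Y + g X (bracket E Y).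
Proof. by rewrite -hE /lie_metric; ring. Qed.

Lemma homothetic_nabla X Y : g (D X E) Y + g X (D Y E) = constf M l * g X Y.
Proof. by rewrite -lie_metric_nabla hE. Qed.

Lemma lie_flat X :
  lie_form E (flat g X) = flat g (bracket E X) + constf M l *: flat g X.
Proof.
by apply: formE => Y; rewrite lie_formE !tensorE !flatE homothetic_app; ring.
Qed.

Lemma lie_sharp u :
  bracket E (sharp g u) = sharp g (lie_form E u) - constf M l *: sharp g u.
Proof.
by rewrite -{2}(sharpK g u) lie_flat sharpD sharpZ sharpK flatK addrK.
Qed.

(** The defect K of the claim is a difference of connections: it is symmetric by
the Jacobi identity and torsion-freeness, and skew for g because E rescales g
by a constant and the connection is metric. As in the uniqueness of the
Levi-Civita connection, these two symmetries force K = 0. *)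
Lemma lie_nabla X Y :
  bracket E (D X Y) = D (bracket E X) Y + D X (bracket E Y).
Proof.
pose K X Y := bracket E (D X Y) - D (bracket E X) Y - D X (bracket E Y).
have Ksym U V : K U V = K V U.
  have := jacobi E U V.
  rewrite -(levi_civita_torsion g U V) -(levi_civita_torsion g (bracket E U)).
  rewrite -(levi_civita_torsion g U (bracket E V)) bracketB => J.
  apply: vfieldE => h; have := congr1 (fun F => vfield_app F h) J.
  rewrite /K !(vfield_addE, vfield_oppE) => /eqP; rewrite -subr_eq0 => /eqP H.
  by apply/eqP; rewrite -subr_eq0 -[X in _ == X]H; apply/eqP; ring.
have Kskew U V W : g (K U V) W + g V (K U W) = 0.
  rewrite /K !tensorE.
  have := bracketE E U (g V W); rewrite (homothetic_app V W).
  rewrite (levi_civita_metric g U V W) !vfieldDE vfield_constf !homothetic_app.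
  rewrite !(levi_civita_metric g _ V W) (levi_civita_metric g U (bracket E V)).
  rewrite (levi_civita_metric g U V (bracket E W)) => /eqP.
  by rewrite -subr_eq0 => /eqP H; rewrite -[RHS]oppr0 -H; ring.
apply/eqP; rewrite -subr_eq0 opprD addrA; apply/eqP.
rewrite -[LHS]/(K X Y).
apply: (@metric_inj _ _ _ g) => Z; rewrite -[0](scale0r Y) metricZl mul0r.
apply: double_eq0.
have sk U V W : g (K U V) W = - g (K U W) V.
  by apply/eqP; rewrite -addr_eq0 (Defs.metric_sym g _ V) Kskew.
rewrite {1}sk Ksym sk opprK Ksym sk Ksym.
by rewrite addNr.
Qed.

(** The symmetric part of the covariant derivative of E is l / 2 times g since E
is homothetic, and the skew part vanishes since g(E) is closed. *)
Lemma homothetic_grad f : flat g E = dform f ->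
  forall X, D X E = constf M (l / 2) *: X.
Proof.
move=> Ef X; apply: (@metric_inj _ _ _ g) => Y.
have closed : g (D X E) Y = g X (D Y E).
  have := levi_civita_form_torsion g (flat g E) X Y.
  rewrite !nabla_flat !Ef !flatE !dformE bracketE subrr => /eqP.
  by rewrite subr_eq0 (Defs.metric_sym g (D Y E)) => /eqP.
apply/eqP; rewrite -subr_eq0; apply/eqP; apply: double_eq0.
have := homothetic_nabla X Y; rewrite -closed => /eqP.
have -> : l = l / 2 + l / 2 by field.
rewrite constfD -subr_eq0 => /eqP H.
by rewrite metricZl -[RHS]H (_ : (l / 2 + l / 2) / 2 = l / 2); [ring | field].
Qed.
End Homothetic.
End LieDerivatives.

(** * The product of a weak quasi-homogeneous pencil *)

Section CotangentAlgebra.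
Variables (R : realType) (n : nat) (M : smoothManifold R n) (g gt : metric M).
Variables (d D0 : R) (E : vfield M).
Hypothesis wqh : weak_qh_pencil g gt d D0 E.
Local Notation C := (smooth_fun M).
Local Notation vfield := (vfield M).
Local Notation form := (Defs.form M).
Implicit Types (X Y Z W : vfield) (a b c u v w : form) (f : C).
Local Notation D := (levi_civita g).
Local Notation Dt := (levi_civita gt).
Local Notation S := (nabla_diff g gt).
Local Notation T := (pencilT gt d E).
Local Notation tmul := (tangent_mul g gt d E).

Let cpt : compatible g gt. Proof. by case: wqh. Qed.
Let hg : homothetic g (1 - d) E. Proof. by case: wqh => _ []. Qed.
Let hgt : homothetic gt D0 E. Proof. by case: wqh => _ []. Qed.
Let TE u : T u = S E u.
Proof. by case: wqh => _ _ _ ->; rewrite circE flatK. Qed.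

Definition pencilT_inv v : form := xget 0 [set w | T w = v].
Local Notation Ti := pencilT_inv.

Lemma pencilT_inj : injective T.
Proof. by case: wqh => _ _ [_ /bij_inj]. Qed.

Lemma pencilT_invK v : T (Ti v) = v.
Proof.
case: wqh => _ _ [_ [Tr TK KT]] _.
by apply: (@xgetPex _ 0 [set w | T w = v]); exists (Tr v); exact: KT.
Qed.

Lemma pencilTK u : Ti (T u) = u.
Proof. by apply: pencilT_inj; rewrite pencilT_invK. Qed.

(** The product u . v on forms, expressed through the difference of the
connections. *)
Definition form_mul u v : form := S (sharp g u) (Ti v).
Local Notation mul := form_mul.

Lemma cotangent_mulE u v : cotangent_mul g gt d E u v = mul u v.
Proof. exact: circE. Qed.

Lemma tangent_mulE X Y : tmul X Y = sharp gt (mul (flat gt X) (flat gt Y)).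
Proof. by rewrite -cotangent_mulE. Qed.

Lemma form_mulT u v : mul u (T v) = S (sharp g u) v.
Proof. by rewrite /form_mul pencilTK. Qed.

Lemma form_mulDl u v w : mul (u + v) w = mul u w + mul v w.
Proof. by rewrite /form_mul sharpD nabla_diffDl. Qed.

Lemma form_mulZl f u v : mul (f *: u) v = f *: mul u v.
Proof. by rewrite /form_mul sharpZ nabla_diffZl. Qed.

Lemma form_mulBl u v w : mul (u - v) w = mul u w - mul v w.
Proof. by rewrite -scaleN1r form_mulDl form_mulZl scaleN1r. Qed.

Lemma form_mul1l v : mul (flat g E) v = v.
Proof. by rewrite /form_mul flatK -TE pencilT_invK. Qed.

(** T is left multiplication by g(E) for o, and right multiplications for o
commute: with u = T a and v = T b both sides are (g(E) o a) o b. *)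
Lemma form_mulC u v : mul u v = mul v u.
Proof.
rewrite -(pencilT_invK u) -(pencilT_invK v) !form_mulT !TE.
have := compatible_circ cpt (flat g E) (Ti u) (Ti v).
by rewrite !circE !flatK.
Qed.

(** In a commutative algebra, associativity is commutation of the right
multiplications. *)
Lemma form_mulA u v w : mul u (mul v w) = mul (mul u v) w.
Proof.
have mulAC a b c : mul (mul a b) c = mul (mul a c) b.
  by have := compatible_circ cpt a (Ti b) (Ti c); rewrite !circE -/form_mul.
by rewrite (form_mulC u) mulAC (form_mulC v).
Qed.

Lemma form_mul_adjoint u v w : mul u v (sharp gt w) = u (sharp gt (mul v w)).
Proof.
rewrite (form_mulC v) /form_mul nabla_diffC form_sharpC.
by rewrite (almost_compatible_diff cpt.1).
Qed.

(** Moving from gt to g by [almost_compatible_diff] turns gt(E) . u into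
g(E) . u = u. *)
Lemma form_mul_euler u : sharp gt (mul (flat gt E) u) = sharp g u.
Proof.
rewrite /form_mul -(almost_compatible_diff cpt.1) flatK -TE.
by rewrite pencilT_invK.
Qed.

Lemma lie_nabla_diff X a :
  lie_form E (S X a) = S (bracket E X) a + S X (lie_form E a).
Proof.
apply: formE => Y; rewrite !(tensorE, lie_formE, nabla_diffE).
by rewrite !vfieldDE (lie_nabla hg) (lie_nabla hgt) !tensorE; ring.
Qed.

(** T is S along E and [E, E] = 0. *)
Lemma lie_pencilT u : lie_form E (T u) = T (lie_form E u).
Proof.
rewrite !TE lie_nabla_diff (_ : bracket E E = 0).
  by rewrite -[X in S X u](scale0r E) nabla_diffZl scale0r add0r.
by apply: vfieldE => f; rewrite bracketE subrr.
Qed.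

(** The only factor that is not invariant is g^*, which E rescales by d - 1. *)
Lemma lie_form_mul u v :
  lie_form E (mul u v) = constf M (d - 1) *: mul u v
    + mul (lie_form E u) v + mul u (lie_form E v).
Proof.
have LTi : lie_form E (Ti v) = Ti (lie_form E v).
  by apply: pencilT_inj; rewrite -lie_pencilT !pencilT_invK.
rewrite /form_mul lie_nabla_diff LTi (lie_sharp hg) -scaleNr -constfN.
by rewrite opprB nabla_diffDl nabla_diffZl [_ + constf M _ *: _]addrC.
Qed.

(** Lowering both arguments and raising the result multiplies the product on
forms by one net factor of gt, hence the extra weight D0. *)
Lemma lie_tangent_mul X Y :
  lie_mul E tmul X Y = constf M (D0 + d - 1) *: tmul X Y.
Proof.
apply: (@flat_inj _ _ _ gt).
rewrite /lie_mul !(flatD, flatN, flatZ) !tangent_mulE !sharpK.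
have := lie_flat hgt (tmul X Y).
rewrite tangent_mulE sharpK lie_form_mul !(lie_flat hgt).
rewrite !(form_mulDl, form_mulZl) !(form_mulC (flat gt X)).
rewrite !(form_mulDl, form_mulZl) => H.
apply: formE => Z; have := congr1 (fun a => form_app a Z) H.
rewrite -[D0 + d - 1]addrA !constfD !tensorE => /eqP.
rewrite eq_sym -subr_eq0 => /eqP {}H.
by apply/eqP; rewrite -subr_eq0 -[X in _ == X]H; apply/eqP; ring.
Qed.

(** The 3-tensor t(X, Y, Z) = gt(X . Y, Z) is totally symmetric, so the right-hand
side may be replaced by its cyclic permutation, the derivative of the product
along E of Y and Z paired with X. Both sides then equal
(z . T y + y . T z - T (y . z) + (d - 1) / 2 (y . z))(X), with y = gt(Y) and
z = gt(Z): on the left since gt(Y . Z, E) = y(g^* z) and g^* is parallel for D,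
on the right since Dt_E u = L_E u - T u + (d - 1) / 2 u. *)
Lemma nabla_mul_euler X Y Z :
  nabla_mul_flat gt tmul X Y Z E = nabla_mul_flat gt tmul E X Y Z.
Proof.
pose c := constf M ((d - 1) / 2).
have cc : constf M (d - 1) = c + c by rewrite -constfD; congr constf; field.
pose t U V W := gt (tmul U V) W.
have tE U V W : t U V W = mul (flat gt U) (flat gt V) W.
  by rewrite /t tangent_mulE sharpE.
have tA U V W : t U V W = t V W U.
  rewrite tE -[W in LHS](flatK gt) form_mul_adjoint flatE Defs.metric_sym.
  by rewrite /t tangent_mulE.
pose N U V W := E (t U V W) - t (Dt E U) V W - t U (Dt E V) W - t U V (Dt E W).
have NE U V W : nabla_mul_flat gt tmul E U V W = N U V W.
  rewrite /nabla_mul_flat /nabla_mul !tensorE /N {1}/t levi_civita_metric /t; ring.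
have NA U V W : N U V W = N V W U.
  by rewrite /N !(tA U V) (tA U) (tA _ V W); ring.
rewrite NE NA -NE.
have contractE u : contract_nabla Dt E u = S E u + (- c) *: u.
  by rewrite -TE /pencilT scaleNr addrC addKr.
set y := flat gt Y; set z := flat gt Z.
(* S along E stands for T here, and c for (d - 1) / 2. *)
transitivity ((mul z (T y) + mul y (T z)) X - S E (mul y z) X + c * mul y z X).
  have tEuler U V : gt (tmul U V) E = flat gt U (sharp g (flat gt V)).
    rewrite -[LHS]/(t U V E) tE -[E in LHS](flatK gt) form_mul_adjoint.
    by rewrite form_mulC form_mul_euler.
  have H := levi_civita_metric gt X (tmul Y Z) E.
  have K : gt (tmul Y Z) (Dt X E) = S E (mul y z) X - c * mul y z X.
    rewrite -[LHS]/(t Y Z (Dt X E)) tE -contract_nablaE contractE !tensorE; ring.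
  have G := nabla_form_cometric g X y z.
  rewrite tEuler K G in H.
  rewrite /nabla_mul_flat /nabla_mul !tensorE !tEuler.
  rewrite (form_sharpC g (flat gt Y)) -!nabla_flat -/y -/z !form_mulT.
  rewrite (nabla_diffC g gt _ X y) (nabla_diffC g gt _ X z).
  rewrite (nabla_diff_nabla g gt X y) (nabla_diff_nabla g gt X z) !tensorE.
  apply/eqP; move/eqP: H; rewrite eq_sym -subr_eq0 => /eqP H.
  by rewrite -subr_eq0 -[X in _ == X]H; apply/eqP; ring.
have LE : nabla_mul_flat gt tmul E Y Z X =
    (nabla_form Dt E (mul y z) - mul (nabla_form Dt E y) z
      - mul y (nabla_form Dt E z)) X.
  rewrite /nabla_mul_flat /nabla_mul !tensorE !tangent_mulE -nabla_sharp !sharpE.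
  by rewrite -!nabla_flat.
rewrite LE !nabla_lie_form !contractE lie_form_mul !TE.
rewrite (form_mulC z) !(form_mulC y) !(form_mulBl, form_mulDl, form_mulZl) cc.
rewrite (form_mulC y z) !tensorE; ring.
Qed.
End CotangentAlgebra.

(** * Pencils and weak F-manifolds *)

Section WeakFManifold.
Variables (R : realType) (n : nat) (M : smoothManifold R n) (g gt : metric M).
Local Notation vfield := (vfield M).
Local Notation form := (Defs.form M).

(** The constant k of the Euler field is D0 + d - 1. The operator in the
definition is again T: lowering the covariant derivative of E with gt differs
from contracting with it by a sign and by L_E gt = D0 gt, and
(D0 + k) / 2 - D0 = (d - 1) / 2. *)
Lemma weak_qh_pencil_Fmanifold (d D0 : R) (E : vfield) :
  weak_qh_pencil g gt d D0 E ->
  weak_Fmanifold (tangent_mul g gt d E) gt E (sharp gt (flat g E)).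
Proof.
move=> wqh; have [_ [_ hgt] [Tlin Tbij] _] := wqh.
have mulC : commutative (tangent_mul g gt d E).
  by move=> X Y; rewrite !tangent_mulE (form_mulC wqh).
have mulDl f X Y Z : tangent_mul g gt d E (f *: X + Y) Z =
    f *: tangent_mul g gt d E X Z + tangent_mul g gt d E Y Z.
  rewrite !tangent_mulE flatD flatZ form_mulDl form_mulZl.
  by rewrite sharpD sharpZ.
split.
- split=> [//|f X Y Z|X Y Z|//|X].
  + by rewrite !(mulC X) mulDl.
  + by rewrite !tangent_mulE !sharpK (form_mulA wqh).
  + by rewrite tangent_mulE sharpK (form_mul1l wqh) flatK.
- split.
    (* Multiplication by E is g^* gt, with inverse gt^* g, applied to the unit. *)
    exists (sharp gt (flat g (sharp gt (flat g E)))).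
    by rewrite tangent_mulE (form_mul_euler wqh) sharpK flatK.
  exists (D0 + d - 1), D0; split=> //; first exact: lie_tangent_mul.
  rewrite (_ : (fun u => _) = pencilT gt d E) //; apply/funext => u.
  apply: formE => Y; rewrite /pencilT !tensorE contract_nablaE flatE.
  have := homothetic_nabla hgt (sharp gt u) Y; rewrite !sharpE => /eqP.
  rewrite -subr_eq0 => /eqP H.
  rewrite (_ : (D0 + (D0 + d - 1)) / 2 = (d - 1) / 2 + D0); last by field.
  rewrite constfD; apply/eqP.
  by rewrite -subr_eq0 -oppr_eq0 -[X in _ == X]H; apply/eqP; ring.
- move=> X Y Z; rewrite !tangent_mulE sharpE Defs.metric_sym sharpE.
  rewrite -[Z in LHS](flatK gt) (form_mul_adjoint wqh).
  by rewrite (form_sharpC gt) flatK.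
- exact: (nabla_mul_euler wqh).
Qed.

Lemma weak_qh_pencil_euler (d D0 : R) (E : vfield) :
  weak_qh_pencil g gt d D0 E -> forall X,
  sharp g (flat gt X) = tangent_mul g gt d E E X.
Proof.
by move=> wqh X; rewrite tangent_mulE (form_mul_euler wqh).
Qed.

(** L_E L_e = L_e L_E - L_e because [e, E] = e; applied to g^* this gives the
weight (d - 1) - 1. *)
Lemma lie_cometric_lie (d : R) (E e : vfield) :
  bracket e E = e ->
  (forall a b, lie_cometric E g a b = constf M (d - 1) * cometric g a b) ->
  (forall a b, lie_cometric e g a b = cometric gt a b) ->
  forall a b, lie_cometric E gt a b = constf M (d - 2) * cometric gt a b.
Proof.
move=> eE LEg Leg a b.
have LeE c : lie_form E (lie_form e c) = lie_form e (lie_form E c) - lie_form e c.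
  have := lie_form_bracket e E c; rewrite eE => H.
  by rewrite {2}H opprB addrC subrK.
have EgE u v : E (cometric g u v) = constf M (d - 1) * cometric g u v +
    cometric g (lie_form E u) v + cometric g u (lie_form E v).
  by rewrite -LEg /lie_cometric; ring.
have EE f : E (e f) = e (E f) - e f.
  by rewrite -[X in _ - vfield_app X f]eE bracketE; ring.
have gB u v w : cometric g (u - v) w = cometric g u w - cometric g v w.
  by rewrite !cometricE !tensorE.
have gBr u v w : cometric g u (v - w) = cometric g u v - cometric g u w.
  by rewrite !cometricE sharpD sharpN !tensorE.
rewrite {1}/lie_cometric -!Leg /lie_cometric !vfieldDE EE !EgE !vfieldDE.
rewrite vfield_constf !LeE !gB !gBr.
rewrite (_ : d - 2 = d - 1 - 1); last by ring.
by rewrite !constfD !constfN constf1; ring.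
Qed.

(** By [homothetic_grad] D_E u = L_E u + (d - 1) / 2 u, while Dt_E u = L_E u -
u(Dt E); the difference of the two is T u. *)
Lemma qh_pencil_weak (d : R) (f : smooth_fun M) : qh_pencil g gt d f ->
  weak_qh_pencil g gt d (2 - d) (grad g f).
Proof.
move=> [cp [eE LEg Leg Let] Taut].
have hg := homothetic_cometric LEg.
have hgt := homothetic_cometric (lie_cometric_lie eE LEg Leg).
rewrite !opprB in hg hgt.
split=> // u; apply: formE => X.
rewrite circE flatK nabla_diff_nabla !nabla_lie_form !tensorE !contract_nablaE.
rewrite (homothetic_grad hg (sharpK g (dform f))) formZr.
rewrite (_ : (1 - d) / 2 = - ((d - 1) / 2)); last by field.
by rewrite constfN; ring.
Qed.

(** Here e is both a Killing field and a gradient for gt. *)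
Lemma qh_pencil_unit_flat (d : R) (f : smooth_fun M) : qh_pencil g gt d f ->
  forall X, levi_civita gt X (grad gt f) = 0.
Proof.
move=> [_ [_ _ _ Let] _] X.
have constf0 : constf M 0 = 0 by exact: smooth_funE.
have he : homothetic gt (- 0) (grad gt f).
  by apply: homothetic_cometric => a b; rewrite Let constf0 mul0r.
rewrite (homothetic_grad he (sharpK gt (dform f))) oppr0 mul0r.
by rewrite constf0 scale0r.
Qed.
End WeakFManifold.

Theorem theorem20 (R : realType) (n : nat) (M : smoothManifold R n)
    (g gt : metric M) :
  (forall (d D : R) (E : vfield M), weak_qh_pencil g gt d D E ->
    let mul := tangent_mul g gt d E in
    let e := sharp gt (flat g E) in
    weak_Fmanifold mul gt E e /\
    (forall X : vfield M, sharp g (flat gt X) = mul E X)) /\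
  (forall (d : R) (f : smooth_fun M), qh_pencil g gt d f ->
    let E := grad g f in
    let mul := tangent_mul g gt d E in
    let e := sharp gt (flat g E) in
    (forall X : vfield M, levi_civita gt X e = 0) /\
    (forall X Y : vfield M, lie_mul E mul X Y = mul X Y)).
Proof.
split=> [d D E wqh | d f qh] /=; split.
- exact: weak_qh_pencil_Fmanifold wqh.
- exact: weak_qh_pencil_euler wqh.
- by move=> X; rewrite sharpK (qh_pencil_unit_flat qh).
- move=> X Y; rewrite (lie_tangent_mul (qh_pencil_weak qh)).
  by rewrite (_ : 2 - d + d - 1 = 1) ?constf1 ?scale1r //; ring.
Qed.
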